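(* Let $G$ be a finite group and $h\in G$. Let $\varphi(g)=hgh^{-1}$ for $g \in G$ and consider the generalized Alexander quandle $A_\varphi(G)$. Let $N=\langle [h,g] : g\in G\rangle$ be the subgroup generated by the commutators $[h,g]=hgh^{-1}g^{-1}$. Then the connected components of the Cayley graph $\Gamma_{A_\varphi(G)}$ are precisely (the subgraphs induced on) the cosets of $N$ in $G$. In particular, $\Gamma_{A_\varphi(G)}$ has $|G:N|$ connected components, each of size $|N|$. Moreover, the induced subgraphs on the connected components are all isomorphic (as directed graphs).
   Context: A quandle is a set $Q$ with a binary operation $\rhd$ such that for all $x,y,z\in Q$: (1) $x\rhd x=x$; (2) for each $y$ the map $R_y(x)=x\rhd y$ is a bijection $Q\to Q$; (3) $(x\rhd y)\rhd z=(x\rhd z)\rhd(y\rhd z)$. For a group $G$ and $\varphi\in\mathrm{Aut}(G)$, the generalized Alexander quandle $A_\varphi(G)$ is the set $G$ with operation $x\rhd y=\varphi(xy^{-1})y$. All graphs are directed graphs, with loops allowed and without multiple edges, so the edge set is a subset of $V\times V$. The (right) Cayley graph $\Gamma_Q$ of a quandle $Q$ is the directed graph with vertex set $Q$ and edge set $\{(x,x\rhd y): x,y\in Q\}$. A directed graph is connected if for every ordered pair of vertices $(u,v)$ there is a directed path from $u$ to $v$; the connected components are the maximal connected induced subgraphs. An isomorphism of directed graphs is a bijection of vertex sets that preserves and reflects directed edges. Cosets of $N$ are the sets $xN$, $x\in G$. *)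

(* Defs.v *)
From HB Require Import structures.
From mathcomp Require Import all_boot all_order all_fingroup.

Set Implicit Arguments.
Unset Strict Implicit.
Unset Printing Implicit Defensive.

Record quandle (Q : Type) := Quandle {
  qop :> Q -> Q -> Q;
  qop_idem : forall x, qop x x = x;
  qop_bij : forall y, bijective (qop^~ y);
  qop_distr : forall x y z, qop (qop x y) z = qop (qop x z) (qop y z)
}.

Section Alexander.
Local Open Scope group_scope.
Variable gT : finGroupType.

Definition alexander_op (phi : gT -> gT) (x y : gT) := phi (x * y^-1) * y.

Section Quandle.
Variables (phi : {perm gT}) (phiA : phi \in Aut [set: gT]).

Let phiM : {morph phi : x y / x * y}.
Proof. by move=> x y; rewrite (morphicP (Aut_morphic phiA)) ?inE. Qed.

Let phi1 : phi 1 = 1.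
Proof. by apply: (mulIg (phi 1)); rewrite -phiM !mul1g. Qed.

Let phiV x : phi x^-1 = (phi x)^-1.
Proof. by apply: (mulIg (phi x)); rewrite -phiM !mulVg phi1. Qed.

Lemma alexander_idem x : alexander_op phi x x = x.
Proof. by rewrite /alexander_op mulgV phi1 mul1g. Qed.

Lemma alexander_bij y : bijective ((alexander_op phi)^~ y).
Proof.
by apply: injF_bij => x z /mulIg /perm_inj /mulIg.
Qed.

Lemma alexander_distr x y z :
  alexander_op phi (alexander_op phi x y) z =
  alexander_op phi (alexander_op phi x z) (alexander_op phi y z).
Proof.
by rewrite /alexander_op !(invMg, phiM, phiV, mulgA, invgK, mulgK, mulgKV).
Qed.

Definition alexander_quandle : quandle gT :=
  Quandle alexander_idem alexander_bij alexander_distr.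

End Quandle.

Section Inner.
Variable h : gT.

Lemma inner_aut_inj : injective (fun g : gT => h * g * h^-1).
Proof. by move=> x y /mulIg /mulgI. Qed.

Definition inner_aut : {perm gT} := perm inner_aut_inj.

Lemma inner_autP : inner_aut \in Aut [set: gT].
Proof.
rewrite inE; apply/andP; split; first by apply/subsetP=> x; rewrite !inE.
by apply/morphicP=> x y _ _; rewrite !permE !mulgA mulgKV.
Qed.

End Inner.

End Alexander.

(* Directed graphs, loops allowed, without multiple edges, on a finite vertex
   set T are relations e : rel T. *)

Definition cayley_graph (Q : finType) (A : quandle Q) : rel Q :=
  fun x z => [exists y, z == A x y].

Definition induced (T : finType) (e : rel T) (S : {set T}) :
  rel {x : T | x \in S} := fun u v => e (val u) (val v).

Definition connected (T : finType) (e : rel T) : bool :=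
  [forall u, forall v, connect e u v].

(* The vertex sets of the maximal connected induced subgraphs. *)
Definition components (T : finType) (e : rel T) : {set {set T}} :=
  [set S : {set T} | maxset (fun C => connected (@induced T e C)) S].

Definition digraph_iso (T1 T2 : finType) (e1 : rel T1) (e2 : rel T2) : Prop :=
  exists2 f : T1 -> T2, bijective f & forall x y, e1 x y = e2 (f x) (f y).

(* Main.v *)
(** An edge of the Cayley graph leads from [x] to [h x (h^y)^-1] with [y]
    arbitrary, where [h^y = y^-1 h y].  All conjugates of [h] agree modulo the
    normal subgroup [N], so an edge stays inside a coset of [N].  Conversely,
    following [#[h]] edges cancels the left factor [h^#[h] = 1]; taking [y = 1]
    in all but the last of them leads from [x] to
    [x h^(1 - #[h]) (h^y)^-1 = x h (h^y)^-1], the product of [x] with a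
    generator of [N], so the whole coset [x N] can be reached from [x].  Right
    translations are automorphisms of the graph, and since [N] is normal they
    permute its cosets transitively. *)

Require Import Defs.
From HB Require Import structures.
From mathcomp Require Import all_boot all_order all_fingroup.

Set Implicit Arguments.
Unset Strict Implicit.
Unset Printing Implicit Defensive.

Local Open Scope group_scope.

Section Digraph.
Variables (T : finType) (e : rel T).

Lemma connect_induced (S : {set T}) (u v : {x : T | x \in S}) :
  connect (@induced T e S) u v -> connect e (val u) (val v).
Proof.
case/connectP=> p + ->; elim: p u => [|w p IHp] u /=; first by rewrite connect0.
by case/andP=> uw /IHp; apply/connect_trans/connect1/uw.
Qed.

(** A path starting in [S] never leaves it, so all its vertices lift to the subtype. *)
Lemma induced_connect (S : {set T}) :
  (forall x y, x \in S -> e x y -> y \in S) ->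
  forall u v : {x : T | x \in S},
  connect e (val u) (val v) -> connect (@induced T e S) u v.
Proof.
move=> clS u v /connectP[p]; elim: p u => [|y p IHp] u /=.
  by move=> _ /val_inj ->; rewrite connect0.
case/andP=> uy py lastp; have yS := clS _ _ (valP u) uy.
apply: (connect_trans (connect1 _)) (IHp (exist _ y yS) py lastp).
exact: uy.
Qed.

(* The vertex [x0] excludes the empty graph, whose only component in the sense
   of [components] is the empty set. *)
Lemma components_connect (x0 : T) :
  connect_sym e -> components e = [set [set y | connect e x y] | x : T].
Proof.
move=> symE; have connC x : connected (@induced T e [set y | connect e x y]).
  apply/forallP=> u; apply/forallP=> v; apply: induced_connect => [y z|].
    by rewrite !inE => xy yz; apply: connect_trans (connect1 yz).
  have := valP u; have := valP v; rewrite !inE => xv xu.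
  by apply: connect_trans xv; rewrite symE.
have subC (S : {set T}) x : connected (@induced T e S) -> x \in S ->
    S \subset [set y | connect e x y].
  move=> cS xS; apply/subsetP=> y yS; rewrite inE.
  have /forallP/(_ (exist _ y yS)) := forallP cS (exist _ x xS).
  exact: connect_induced.
apply/setP=> S; rewrite inE; apply/maxsetP/imsetP => [[cS maxS]|[x _ ->]].
  have [S0|[x xS]] := set_0Vmem S.
    by exists x0; rewrite // (maxS _ (connC x0)) // S0 sub0set.
  by exists x; rewrite // (maxS _ (connC x)) // subC.
split=> // B cB xB; apply/eqP; rewrite eqEsubset xB andbT subC //.
by rewrite (subsetP xB) // inE connect0.
Qed.

Lemma induced_iso (f g : T -> T) (C D : {set T}) :
  cancel f g -> cancel g f -> (forall x y, e (f x) (f y) = e x y) ->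
  (forall x, (f x \in D) = (x \in C)) ->
  digraph_iso (@induced T e C) (@induced T e D).
Proof.
move=> fK gK fE fD.
have fP (u : {x | x \in C}) : f (val u) \in D by rewrite fD (valP u).
have gP (v : {x | x \in D}) : g (val v) \in C by rewrite -fD gK (valP v).
exists (fun u => exist (fun x => x \in D) _ (fP u)); last by move=> u v; rewrite /induced fE.
by exists (fun v => exist (fun x => x \in C) _ (gP v)) => u; apply: val_inj; rewrite /= ?fK ?gK.
Qed.

End Digraph.

Section InnerAlexander.
Variables (gT : finGroupType) (h : gT).

Local Notation Gamma := (cayley_graph (alexander_quandle (inner_autP h))).
Local Notation N := <<[set h * g * h^-1 * g^-1 | g : gT]>>.

Lemma inner_edgeP x z :
  reflect (exists y, z = h * x * (h ^ y)^-1) (Gamma x z).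
Proof.
have E y : alexander_quandle (inner_autP h) x y = h * x * (h ^ y)^-1.
  by rewrite /= /alexander_op permE /conjg !invMg invgK !mulgA.
by apply: (iffP existsP) => -[y]; [move/eqP|]; move=> zE; exists y;
  rewrite ?zE E.
Qed.

(** This is the commutator of [h] and [g^-1]: a generator of [N], in the form in which edges produce
    it. *)
Lemma mul_conjV_mem g : h * (h ^ g)^-1 \in N.
Proof.
by apply/mem_gen/imsetP; exists g^-1; rewrite // /conjg !invMg !invgK !mulgA.
Qed.

Lemma commutators_normal : N <| [set: gT].
Proof.
rewrite /normal subsetT; apply/subsetP=> k _; rewrite inE -genJ gen_subG.
apply/subsetP=> _ /imsetP[_ /imsetP[g _ ->] ->].
(* [[h,g]^k = (h (h^k)^-1)^-1 (h (h^(g^-1 k))^-1)] *)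
have -> : (h * g * h^-1 * g^-1) ^ k
          = (h * (h ^ k)^-1)^-1 * (h * (h ^ (g^-1 * k))^-1).
  by rewrite /conjg !invMg !invgK !mulgA !(mulgK, mulgKV).
by rewrite groupM ?groupV ?mul_conjV_mem.
Qed.

Lemma inner_edge_lcoset x z : Gamma x z -> z \in x *: N.
Proof.
case/inner_edgeP=> y ->; rewrite mem_lcoset.
(* The left side is [h ^ x * (h ^ y)^-1]; insert [h^-1 * h] between the two conjugates. *)
have -> : x^-1 * (h * x * (h ^ y)^-1) = (h * (h ^ x)^-1)^-1 * (h * (h ^ y)^-1).
  by rewrite /conjg !invMg !invgK !mulgA !(mulgK, mulgKV).
by rewrite groupM ?groupV ?mul_conjV_mem.
Qed.

Lemma connect_inner_pow n x : connect Gamma x (h ^+ n * x * h ^- n).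
Proof.
elim: n => [|n IHn]; first by rewrite mul1g invg1 mulg1 connect0.
apply: connect_trans IHn (connect1 _); apply/inner_edgeP; exists 1.
by rewrite conjg1 expgS invMg !mulgA.
Qed.

Lemma connect_inner_gen x g : connect Gamma x (x * (h * (h ^ g)^-1)).
Proof.
apply: connect_trans (connect_inner_pow #[h].-1 x) (connect1 _).
apply/inner_edgeP; exists g.
have hn : h * h ^+ #[h].-1 = 1 by rewrite -expgS prednK ?order_gt0 ?expg_order.
(* By [hn], the right factor [h ^- #[h].-1] left by the first edges equals [h]. *)
by rewrite !mulgA hn mul1g -(mulg1_eq hn) invgK.
Qed.

Lemma connect_inner x y : connect Gamma x y = (y \in x *: N).
Proof.
apply/idP/idP=> [/connectP[p + ->]|].
  elim: p x => [|z p IHp] x /=; first by rewrite lcoset_refl.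
  by case/andP=> /inner_edge_lcoset/lcoset_eqP<- /IHp.
(* Quantifying over all [z] makes [M] closed under products, which suffices for a subgroup since
   [gT] is finite. *)
pose M := [set n | [forall z, connect Gamma z (z * n)]].
have gM : group_set M.
  apply/group_setP; split=> [|m n].
    by rewrite inE; apply/forallP=> z; rewrite mulg1 connect0.
  rewrite !inE => /forallP cm /forallP cn; apply/forallP=> z.
  by rewrite mulgA; apply: connect_trans (cm z) (cn _).
have sNM : N \subset group gM.
  rewrite gen_subG; apply/subsetP=> _ /imsetP[g _ ->]; rewrite inE.
  apply/forallP=> z; have := connect_inner_gen z g^-1.
  by rewrite /conjg !invMg !invgK !mulgA.
rewrite mem_lcoset => /(subsetP sNM); rewrite inE => /forallP/(_ x).
by rewrite mulKVg.
Qed.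

Lemma components_inner : components Gamma = lcosets N [set: gT].
Proof.
(* Reachability is symmetric because it amounts to lying in the same coset. *)
rewrite (components_connect (1 : gT)) => [|x y]; last first.
  by rewrite !connect_inner lcoset_sym.
apply/setP=> C; apply/imsetP/imsetP => -[x _ ->]; exists x => //.
  by apply/setP=> y; rewrite inE connect_inner lcosetE.
by apply/setP=> y; rewrite inE connect_inner lcosetE.
Qed.

(** Right translation by [a] is a quandle automorphism: the edge given by [y] goes to the edge given
    by [y * a]. *)
Lemma inner_edge_mulr a x z : Gamma (x * a) (z * a) = Gamma x z.
Proof.
apply/inner_edgeP/inner_edgeP => -[y zE].
  exists (y * a^-1); apply: (mulIg a).
  by rewrite zE /conjg !invMg !invgK !mulgA !(mulgK, mulgKV).
by exists (y * a); rewrite zE /conjg !invMg !invgK !mulgA !(mulgK, mulgKV).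
Qed.

End InnerAlexander.

Theorem corollary4p10 (gT : finGroupType) (h : gT) :
  let Gamma := cayley_graph (alexander_quandle (inner_autP h)) in
  let N := <<[set h * g * h^-1 * g^-1 | g : gT]>> in
  [/\ components Gamma = lcosets N [set: gT],
      #|components Gamma| = #|[set: gT] : N|,
      forall C, C \in components Gamma -> #|C| = #|N|
    & forall C D, C \in components Gamma -> D \in components Gamma ->
        digraph_iso (@induced gT Gamma C) (@induced gT Gamma D)].
Proof.
move=> Gamma N; rewrite components_inner -/N; split=> //.
- exact: card_lcosets.
- by move=> _ /lcosetsP[x _ ->]; rewrite card_lcoset.
move=> _ _ /lcosetsP[a _ ->] /lcosetsP[b _ ->].
have lrN x : x *: N = N :* x.
  by rewrite norm_rlcoset // (subsetP (normal_norm (commutators_normal h))) ?inE.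
(* Translation by [a^-1 * b] takes [N :* a] to [N :* b], which by [lrN] are the given left
   cosets. *)
apply: (induced_iso (mulgK (a^-1 * b)) (mulgKV (a^-1 * b))) => [x y|x].
  exact: inner_edge_mulr.
by rewrite !lrN !mem_rcoset !mulgA mulgK.
Qed.
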